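(* Let $G$ be a locally compact second countable unimodular group with a fixed Haar measure $m_G$. For every transverse $G$-space $(X,\mu,Y)$ and every $r\in\mathbb{N}$, $$I^r_\mu(Y)=\int_{Y^{\otimes r}}m_G\bigl(\Theta(Y_{y_1}\cap\dots\cap Y_{y_r},\,e_G)\bigr)\,d\mu_Y^{\otimes r}(y_1,\dots,y_r),$$ for any choice of an equivariant Voronoi tessellation scheme $P\mapsto\{\Theta(P,p):p\in P\}$ of $G$.
   Context: A Borel $G$-space is a standard Borel space $X$ with a jointly Borel action $G\times X\to X$, $(g,x)\mapsto g.x$. For $Y\subseteq X$ and $x\in X$ put $Y_x=\{g\in G: g.x\in Y\}$. A subset of $G$ is locally finite if it meets every compact set in a finite set. A cross section of $X$ is a Borel set $Y\subseteq X$ with $Y_x$ nonempty and locally finite for every $x\in X$. A transverse $G$-space $(X,\mu,Y)$ consists of a Borel $G$-space $X$, a $G$-invariant Borel probability measure $\mu$ on $X$, and a Borel set $Y\subseteq X$ such that $G.Y$ (a Borel set) is $\mu$-conull, $Y_x$ is locally finite for all $x\in G.Y$, and $\int_X|Y_x\cap K|\,d\mu(x)<\infty$ for every compact $K\subset G$. Transverse measure: for a $G$-invariant $\sigma$-finite measure $\mu$ on a Borel $G$-space $X$ for which $Y$ is a cross section (of $X$, or of a conull invariant Borel subset), $\mu_Y$ is the measure on $Y$ given by $\mu_Y(f)=\int_X\sum_{g\in Y_x}f(g.x)w(g)\,d\mu(x)$ for Borel $f:Y\to[0,+\infty]$, where $w:G\to[0,+\infty]$ is any Borel function with $\int_G w\,dm_G=1$;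 it is $\sigma$-finite and does not depend on $w$. Intersection covolume: $Y^{\otimes r}$ is the $r$-fold product and $Y^{[r]}=\{(g.y_1,\dots,g.y_r):g\in G,\ y_i\in Y\}\subseteq X^{\otimes r}$, a Borel $G$-space under the diagonal action, having $Y^{\otimes r}$ as a cross section. There is exactly one $G$-invariant $\sigma$-finite Borel measure $\mu^{[r]}$ on $Y^{[r]}$ whose transverse measure on $Y^{\otimes r}$ is $\mu_Y^{\otimes r}$. Set $I^r_\mu(Y)=\mu^{[r]}(Y^{[r]})$. Equivariant Voronoi tessellation scheme: let $d$ be a right-invariant proper metric on $G$ inducing its topology, and let $\prec$ be a Borel linear order on $G$. For a nonempty locally finite $P\subset G$ and $x\in G$ let $D(x,P)=\{p\in P: d(x,p)=\inf_{q\in P}d(x,q)\}$ (finite and nonempty), and for $p\in P$ $$\Theta(P,p)=\{x\in G:\ p\in D(x,P)\text{ and }xp^{-1}=\min\nolimits_{\prec}\,xD(x,P)^{-1}\},$$ where $xD(x,P)^{-1}=\{xq^{-1}:q\in D(x,P)\}$. These cells form a Borel partition of $G$ and $\Theta(Pg,pg)=\Theta(P,p)g$ for all $g\in G$. *)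

(* Defs.v *)
(* Built on MathComp and MathComp-Analysis. *)
From HB Require Import structures.
From mathcomp Require Import all_boot all_order all_algebra.
From mathcomp Require Import all_classical all_reals all_analysis.
From mathcomp Require Import measurable_realfun.

Set Implicit Arguments.
Unset Strict Implicit.
Unset Printing Implicit Defensive.

Import Order.TTheory GRing.Theory Num.Theory.

Local Open Scope classical_set_scope.
Local Open Scope ring_scope.

HB.mixin Record isTopologicalGroup (G : Type)
    of Group G & PointedTopological G := {
  mulg_continuous : continuous (fun gh : G * G => (gh.1 * gh.2)%g) ;
  invg_continuous : continuous (fun g : G => (g^-1)%g)
}.

(* MathComp-Analysis only defines a generated sigma-algebra on a pointed type;
   the base point is arbitrary and need not be the neutral element. *)
#[short(type="topologicalGroupType")]
HB.structure Definition TopologicalGroup :=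
  {G of isTopologicalGroup G & Group G & PointedTopological G}.

(* The type T, carrying its Borel sigma-algebra. *)
Notation borel T := (g_sigma_algebraType (@open T)).

(* Local compactness and second countability, with the usual convention that
   topological groups are Hausdorff. *)
Definition lcsc (G : topologicalGroupType) : Prop :=
  [/\ hausdorff_space G, locally_compact [set: G] & @second_countable G].

Section haar.
Context {R : realType} {G : topologicalGroupType}.
Implicit Type m : {measure set (borel G) -> \bar R}.

Definition left_invariant_measure m : Prop :=
  forall (g : G) (A : set (borel G)), measurable A ->
    m [set h | A (g * h)%g] = m A.

Definition right_invariant_measure m : Prop :=
  forall (g : G) (A : set (borel G)), measurable A ->
    m [set h | A (h * g)%g] = m A.

(* On a locally compact second countable group, a Borel measure that is finite
   on compact sets is automatically regular. *)
Definition haar_measure m : Prop :=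
  [/\ left_invariant_measure m,
      forall K : set G, compact K -> (m K < +oo)%E
    & (0 < m setT)%E].

End haar.

Definition unimodular (R : realType) (G : topologicalGroupType) : Prop :=
  forall m : {measure set (borel G) -> \bar R},
    haar_measure m -> right_invariant_measure m.

Definition locally_finite {G : topologicalType} (P : set G) : Prop :=
  forall K : set G, compact K -> finite_set (P `&` K).

(* The measurable structure of X is the Borel structure of some Polish topology
   on X; that topology is presented by a bijection onto a Polish space. *)
Definition standard_borel (R : realType) d (X : measurableType d) : Prop :=
  exists (P : completePseudoMetricType R) (f : X -> P),
    [/\ hausdorff_space P, @second_countable P, bijective f
      & @measurable d X = preimage_set_system setT f <<s @open P >>].

Section actions.
Context {G : topologicalGroupType}.

Definition is_action (T : Type) (act : G -> T -> T) : Prop :=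
  (forall x, act 1%g x = x) /\
  (forall g h x, act (g * h)%g x = act g (act h x)).

Definition borel_G_space (R : realType) d (X : measurableType d)
    (act : G -> X -> X) : Prop :=
  [/\ standard_borel R X, is_action act
    & measurable_fun [set: borel G * X]
        (fun gx : borel G * X => act gx.1 gx.2)].

(* Y_x *)
Definition return_set (T : Type) (act : G -> T -> T) (Y : set T) (x : T) :
  set G := [set g | Y (act g x)].

(* G.Y *)
Definition saturation (T : Type) (act : G -> T -> T) (Y : set T) : set T :=
  [set x | exists g, exists2 y, Y y & x = act g y].

Definition diag_act (T : Type) (r : nat) (act : G -> T -> T) :
  G -> r.-tuple T -> r.-tuple T := fun g x => [tuple of map (act g) x].

End actions.
Arguments diag_act {G T} r act.

(* Y^{(x) r} *)
Definition set_power (T : Type) (r : nat) (Y : set T) : set (r.-tuple T) :=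
  [set y | forall i : 'I_r, Y (tnth y i)].
Arguments set_power {T} r Y.

(* Y^{[r]} *)
Definition diag_saturation {G : topologicalGroupType} (T : Type) (r : nat)
    (act : G -> T -> T) (Y : set T) : set (r.-tuple T) :=
  saturation (diag_act r act) (set_power r Y).
Arguments diag_saturation {G T} r act Y.

Definition invariant_measure {R : realType} {G : topologicalGroupType} d
    (X : measurableType d) (act : G -> X -> X)
    (mu : {measure set X -> \bar R}) : Prop :=
  forall (g : G) (A : set X), measurable A -> mu (act g @^-1` A) = mu A.

Definition transverse_space {R : realType} {G : topologicalGroupType} d
    (X : measurableType d) (act : G -> X -> X) (mu : probability X R)
    (Y : set X) : Prop :=
  [/\ borel_G_space R act,
      invariant_measure act mu,
      measurable Y,
      {ae mu, forall x, saturation act Y x} &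
      (forall x, saturation act Y x -> locally_finite (return_set act Y x)) /\
      (forall K : set G, compact K ->
        (\int[mu]_x counting (return_set act Y x `&` K) < +oo)%E)].

(* Measures on a subset Y of X are represented by measures on X carried by Y.
   Taking for f the indicator function of ~` Y shows that muY is carried by Y.
   The sum vanishes at points outside saturation act Y, so that Y need only be
   a cross section of its saturation. *)
Definition transverse_measure {R : realType} {G : topologicalGroupType} d
    (X : measurableType d) (mG : {measure set (borel G) -> \bar R})
    (act : G -> X -> X) (mu : {measure set X -> \bar R}) (Y : set X)
    (muY : {measure set X -> \bar R}) : Prop :=
  forall w : borel G -> \bar R,
    measurable_fun [set: borel G] w -> (forall g, (0 <= w g)%E) ->
    (\int[mG]_g w g = 1)%E ->
  forall f : X -> \bar R,
    measurable_fun [set: X] f -> (forall x, (0 <= f x)%E) ->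
    (\int[muY]_y f y =
     \int[mu]_x \esum_(g in return_set act Y x) (f (act g x) * w g))%E.

(* rho is the r-fold product of the sigma-finite measure mu. *)
Definition power_measure {R : realType} d (X : measurableType d) (r : nat)
    (mu : {measure set X -> \bar R})
    (rho : {measure set (r.-tuple X) -> \bar R}) : Prop :=
  forall A : 'I_r -> set X, (forall i, measurable (A i)) ->
    rho [set x | forall i, A i (tnth x i)] = (\prod_(i < r) mu (A i))%E.

(* nu is mu^{[r]}, where rho is the r-fold product of mu_Y; as above, a measure
   on diag_saturation r act Y is represented by a measure on X^r carried by
   this set. *)
Definition intersection_measure {R : realType} {G : topologicalGroupType} d
    (X : measurableType d) (r : nat)
    (mG : {measure set (borel G) -> \bar R}) (act : G -> X -> X) (Y : set X)
    (rho nu : {measure set (r.-tuple X) -> \bar R}) : Prop :=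
  [/\ invariant_measure (diag_act r act) nu,
      sigma_finite setT nu,
      {ae nu, forall x, diag_saturation r act Y x}
    & transverse_measure mG (diag_act r act) nu (set_power r Y) rho].

Section voronoi.
Context {R : realType} {G : topologicalGroupType}.

Definition is_metric (dist : G -> G -> R) : Prop :=
  [/\ forall x y, 0 <= dist x y,
      forall x y, dist x y = 0 <-> x = y,
      forall x y, dist x y = dist y x
    & forall x y z, dist x z <= dist x y + dist y z].

(* A right-invariant proper metric inducing the topology of G. *)
Definition voronoi_metric (dist : G -> G -> R) : Prop :=
  [/\ is_metric dist,
      forall x y g : G, dist (x * g)%g (y * g)%g = dist x y,
      forall (x : G) (t : R), compact [set y | dist x y <= t]
    & forall (x : G) (A : set G),
        nbhs x A <-> exists2 e, 0 < e & [set y | dist x y < e] `<=` A].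

Definition borel_linear_order (prec : G -> G -> Prop) : Prop :=
  [/\ forall g, ~ prec g g,
      forall g h k, prec g h -> prec h k -> prec g k,
      forall g h, g <> h -> prec g h \/ prec h g
    & measurable [set gh : borel G * borel G | prec gh.1 gh.2]].

Definition is_min (prec : G -> G -> Prop) (A : set G) (m : G) : Prop :=
  A m /\ forall a, A a -> a <> m -> prec m a.

(* D(x, P) *)
Definition nearest (dist : G -> G -> R) (x : G) (P : set G) : set G :=
  [set p | P p /\ dist x p = inf [set dist x q | q in P]].

(* Theta(P, p) *)
Definition voronoi_cell (dist : G -> G -> R) (prec : G -> G -> Prop)
    (P : set G) (p : G) : set G :=
  [set x | nearest dist x P p /\
    is_min prec [set (x * q^-1)%g | q in nearest dist x P] (x * p^-1)%g].

End voronoi.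

(* Main.v *)
Require Import Defs.
From HB Require Import structures.
From mathcomp Require Import all_boot all_order all_algebra.
From mathcomp Require Import all_classical all_reals all_analysis.
From mathcomp Require Import measurable_realfun lra.

(** Let [Z] be the space of [r]-tuples with the diagonal action of [G], let [Yr] be
the power of [Y], [nu] the measure on [Z] with transverse measure [rho] on [Yr],
and [P z] the return set of [z], which is locally finite. Return sets satisfy
P (h.z) = P z h^-1, and Voronoi cells are equivariant under right translations.
Every element of [G] lies in exactly one cell of [P z] when [P z] is not empty,
that is, when [z] is in the saturation of [Yr]; call the point of that cell the
centre of the element.

Fix a compact set [K] of positive Haar measure [m(K)], and use the weight
1_K / m(K) in the formula for the transverse measure. Right invariance of the
Haar measure (this is where unimodularity enters) turns the integral over [Yr]
of the measures of the cells of the neutral element into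
  1/m(K) * int_Z m { h : the centre of h for P z lies in K } dnu(z),
because the cells of the points of [P z] in [K] are disjoint
([esum_voronoi_cells]). Exchange the integrals, replace [z] by [h^-1.z], which
preserves [nu], and exchange them again. The centre of [h] for [P (h^-1.z)] is
g h, where [g] is the centre of the neutral element for [P z]. So the inner
integral becomes the measure of a left translate of [K] if [z] is in the
saturation of [Yr], and 0 otherwise; this leaves the measure of the saturation.
See [measure_saturation_voronoi].

The other half of the proof is measurability: the saturation must be measurable
for its measure to make sense, and the cells must depend measurably on all
parameters for Fubini's theorem. Both are projections along [G] of Borel
sets with locally finite sections ([measurable_proj_locally_finite]), while
projections of Borel sets are in general only analytic. The reduction to compact
[K] and closed sections goes through the theorem of Kunugi and Novikov: a Borel
set in [G * Z] with open sections is a countable union of rectangles with open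
and Borel sides. It is proved in [suslin_rectangle_separable] by a tree
argument on Suslin schemes, which Borel sets possess because [G] is locally
compact and second countable and [Z] is standard Borel. *)

Set Implicit Arguments.
Unset Strict Implicit.
Unset Printing Implicit Defensive.

Import Order.TTheory GRing.Theory Num.Theory.

Local Open Scope classical_set_scope.
Local Open Scope ring_scope.

(** * Suslin schemes *)

Definition branch (v : nat -> seq nat) :=
  v 0%N = [::] /\ forall j, exists k, v j.+1 = rcons (v j) k.

(** Convergence is tested only against a class [U] of sets, which plays the part
of a topology: such classes pull back along maps and multiply without any
topology on the underlying types. *)
Definition shrinks_into T (U : set (set T)) (D : nat -> set T) (A : set T) :=
  (exists j, D j = set0) \/
  exists2 a, A a & forall B, U B -> B a -> exists j, D j `<=` B.

(** [A] is the kernel of a Suslin scheme all of whose branches die out or shrink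
to a point of [A]. For the open sets of a Hausdorff space this describes the
analytic sets: the scheme lists the images of basic open sets under a continuous
map from a closed part of the Baire space. *)
Definition suslin T (U : set (set T)) (A : set T) :=
  exists D : seq nat -> set T,
  [/\ D [::] = A, forall s, D s `<=` \bigcup_k D (rcons s k),
      forall s k, D (rcons s k) `<=` D s &
      forall v, branch v -> shrinks_into U (D \o v) A].

(** Nodes of an arbitrary type spare the coding of products and intersections of
schemes by sequences of integers. *)
Lemma suslin_tree T (U : set (set T)) (N : Type) (root : N)
    (child : N -> nat -> N) (D : N -> set T) :
  (forall v, D v `<=` \bigcup_k D (child v k)) ->
  (forall v k, D (child v k) `<=` D v) ->
  (forall p : nat -> N, p 0%N = root ->
     (forall j, exists k, p j.+1 = child (p j) k) ->
     shrinks_into U (D \o p) (D root)) ->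
  suslin U (D root).
Proof.
move=> Dcov Dsub Dsh; exists (fun s => D (foldl child root s)); split => //.
- by move=> s x /Dcov[k _ Dk]; exists k => //; rewrite foldl_rcons.
- by move=> s k; rewrite foldl_rcons.
- move=> v [v0 vS].
  apply: (Dsh (fun j => foldl child root (v j))); first by rewrite v0.
  by move=> j; have [k ->] := vS j; exists k; rewrite foldl_rcons.
Qed.

Lemma decreasing_chain T (D : nat -> set T) :
  (forall j, D j.+1 `<=` D j) -> forall i j, (i <= j)%N -> D j `<=` D i.
Proof.
move=> DS i j; elim: j => [|j IH]; first by rewrite leqn0 => /eqP ->.
rewrite leq_eqVlt => /orP[/eqP -> //|]; rewrite ltnS => /IH.
exact: subset_trans.
Qed.

Lemma scheme_branch_decreasing T (D : seq nat -> set T) v :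
  (forall s k, D (rcons s k) `<=` D s) -> branch v ->
  forall i j, (i <= j)%N -> D (v j) `<=` D (v i).
Proof.
move=> Dsub [_ vS]; apply: decreasing_chain => j.
by have [k ->] := vS j; exact: Dsub.
Qed.

Definition separates_points T (U : set (set T)) :=
  forall a b, a <> b -> exists A B, [/\ U A, U B, A a, B b & A `&` B = set0].

Lemma suslin0 T (U : set (set T)) : suslin U set0.
Proof.
by exists (fun=> set0); split => [|s x []|s k|v _] //; left; exists 0%N.
Qed.

Lemma suslin_bigcup T (U : set (set T)) (A : nat -> set T) :
  (forall n, suslin U (A n)) -> suslin U (\bigcup_n A n).
Proof.
move=> /choice[D DP].
pose child (o : option (nat * seq nat)) k :=
  if o is Some (n, s) then Some (n, rcons s k) else Some (k, [::]).
pose E (o : option (nat * seq nat)) :=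
  if o is Some (n, s) then D n s else \bigcup_n A n.
apply: (@suslin_tree _ _ _ None child E).
- move=> [[n s]|] /=; first by have [_ + _ _] := DP n; exact.
  by move=> x [n _ Ax]; exists n => //; have [-> _ _ _] := DP n.
- move=> [[n s]|] k /=; first by have [_ _ + _] := DP n; exact.
  by have [-> _ _ _] := DP k; exact: bigcup_sup.
- move=> p p0 pS.
  have [n p1] : exists n, p 1%N = Some (n, [::]).
    by have [n] := pS 0%N; rewrite p0; exists n.
  have [v vE] : {v : nat -> seq nat | forall j, p j.+1 = Some (n, v j)}.
    exists (fun j => if p j.+1 is Some (_, s) then s else [::]).
    elim=> [|j IH]; first by rewrite p1.
    by have [k ->] := pS j.+1; rewrite IH.
  have bv : branch v.
    split; first by have := vE 0%N; rewrite p1 => -[].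
    by move=> j; have [k] := pS j.+1; rewrite !vE => -[->]; exists k.
  have [_ _ _ /(_ v bv)[[j Dj]|[a Aa aP]]] := DP n.
    by left; exists j.+1; rewrite /= vE.
  right; exists a; first by exists n.
  by move=> B UB /(aP _ UB)[j Dj]; exists j.+1; rewrite /= vE.
Qed.

(** A countable product of schemes has to make finitely many choices at each step,
with a single integer to record them. *)
Lemma nat_codes_prefixes : exists dec : nat -> nat -> nat,
  forall m g, exists k, forall n, (n <= m)%N -> dec k n = g n.
Proof.
exists (fun k => nth 0%N (CodeSeq.decode k)) => m g.
exists (CodeSeq.code (mkseq g m.+1)) => n nm.
by rewrite CodeSeq.codeK nth_mkseq.
Qed.

(** The schemes run in parallel, the [n]-th one being started at step [n], so that
only finitely many of them branch at each step. Along a branch they converge to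
points of the sets [A n], and these points coincide: the intersections are not
empty, and distinct points are separated by [U]. *)
Lemma suslin_bigcap T (U : set (set T)) (A : nat -> set T) :
  separates_points U ->
  (forall n, suslin U (A n)) -> suslin U (\bigcap_n A n).
Proof.
move=> sepU /choice[D DP]; have [dec decP] := nat_codes_prefixes.
pose child (mf : nat * (nat -> seq nat)) k := (mf.1.+1, fun n =>
  if (n <= mf.1)%N then rcons (mf.2 n) (dec k n)
  else mf.2 n).
pose E (mf : nat * (nat -> seq nat)) := \bigcap_n D n (mf.2 n).
pose root : nat * (nat -> seq nat) := (0%N, fun=> [::]).
have ER : E root = \bigcap_n A n.
  by apply: eq_bigcap => // n _; have [-> _ _ _] := DP n.
rewrite -ER; apply: (@suslin_tree _ _ _ root child E).
- move=> [m f] x Ex.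
  have /choice[g gP] n : exists k, D n (rcons (f n) k) x.
    have [_ /(_ (f n) x) + _ _] := DP n.
    by case=> [|k _ ?]; [exact: Ex|exists k].
  have [k kP] := decP m g; exists k => // n _ /=.
  by case: leqP => nm; [rewrite kP|exact: Ex].
- move=> [m f] k x Ex n _; have := Ex n I; rewrite /=; case: ifP => // _.
  by have [_ _ + _] := DP n; apply.
- move=> p p0 pS.
  have p1 j : (p j).1 = j.
    by elim: j => [|j IH]; [rewrite p0|have [k ->] := pS j; rewrite /= IH].
  have pn n j : (j <= n)%N -> (p j).2 n = [::].
    elim: j => [|j IH] jn; first by rewrite p0.
    have [k ->] := pS j; rewrite /= p1 leqNgt jn /=; apply: IH.
    exact: ltnW.
  pose v n j := (p (j + n)%N).2 n.
  have bv n : branch (v n).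
    split; first by rewrite /v add0n pn.
    move=> j; rewrite /v addSn; have [k ->] := pS (j + n)%N.
    by rewrite /= p1 leq_addl; eexists.
  have Edec : forall i j, (i <= j)%N -> E (p j) `<=` E (p i).
    apply: decreasing_chain => j; have [k -> x Ex n _] := pS j.
    have := Ex n I; rewrite /=; case: ifP => // _.
    by have [_ _ + _] := DP n; apply.
  have EsD n j : E (p (j + n)%N) `<=` D n (v n j) by move=> x /(_ n I).
  have [[j Ej]|/forallNP Ene] := pselect (exists j, E (p j) = set0).
    by left; exists j.
  have /choice[a aP] n : exists a, A n a /\
      forall B, U B -> B a -> exists j, E (p j) `<=` B.
    have [_ _ _ /(_ _ (bv n))[[j Dj]|[a Aa aP]]] := DP n.
      by case: (Ene (j + n)%N); rewrite -subset0 -Dj; exact: EsD.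
    exists a; split => // B UB /(aP _ UB)[j DB]; exists (j + n)%N.
    exact: subset_trans (EsD _ _) DB.
  have aE n : a n = a 0%N.
    apply: contrapT => /sepU[B [C [UB UC Ba Ca BC]]].
    have [_ /(_ _ UB Ba)[j jB]] := aP n.
    have [_ /(_ _ UC Ca)[i iC]] := aP 0%N.
    case: (Ene (maxn i j)); rewrite -subset0 -BC => x Ex.
    by split; [apply/jB/(Edec _ _ (leq_maxr i j))
              |apply/iC/(Edec _ _ (leq_maxl i j))].
  right; exists (a 0%N); last by have [] := aP 0%N.
  by rewrite ER => n _; rewrite -(aE n); have [] := aP n.
Qed.

(** Complements of Suslin sets need not be Suslin, so one collects the sets that
are Suslin together with their complement. *)
Lemma suslin_sigma_algebra T (U : set (set T)) :
  separates_points U -> suslin U setT ->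
  sigma_algebra setT [set A | suslin U A /\ suslin U (~` A)].
Proof.
move=> sU sT; split => /=.
- by split; [exact: suslin0|rewrite setC0].
- by move=> A [sA sCA]; rewrite setTD setCK.
- move=> F sF; split; first by apply: suslin_bigcup => n; case: (sF n).
  by rewrite setC_bigcup; apply: suslin_bigcap => // n; case: (sF n).
Qed.

(** The properties of the open sets of a standard Borel space on which
projection theorems rest, freed from the topology. *)
Definition lusin_class d (T : measurableType d) (U : set (set T)) :=
  [/\ U `<=` measurable, separates_points U &
      forall A, measurable A -> suslin U A].

Lemma suslin_image T1 T2 (U1 : set (set T1)) (U2 : set (set T2))
    (f : T1 -> T2) (A : set T1) :
  (forall B, U2 B -> U1 (f @^-1` B)) -> suslin U1 A -> suslin U2 (f @` A).
Proof.
move=> fU [D [D0 Dcov Dsub Dsh]]; exists (fun s => f @` D s); split.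
- by rewrite D0.
- by move=> s _ [x /Dcov[k _ Dk] <-]; exists k => //; exists x.
- by move=> s k; exact/image_subset/Dsub.
- move=> v /Dsh[[j Dj]|[a Aa aP]];
    first by left; exists j; rewrite /= (Dj : D (v j) = set0) image_set0.
  right; exists (f a); first by exists a.
  by move=> B /fU/aP aB /aB[j jB]; exists j => _ [x /jB fx <-].
Qed.

(** A subbase is enough, because [shrinks_into] tests one set at a time. *)
Definition prod_class T1 T2 (U1 : set (set T1)) (U2 : set (set T2)) :
    set (set (T1 * T2)) :=
  [set fst @^-1` A | A in U1] `|` [set snd @^-1` B | B in U2].

Lemma suslin_setX T1 T2 (U1 : set (set T1)) (U2 : set (set T2)) A1 A2 :
  suslin U1 A1 -> suslin U2 A2 -> suslin (prod_class U1 U2) (A1 `*` A2).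
Proof.
move=> [D [D0 Dcov Dsub Dsh]] [E [E0 Ecov Esub Esh]].
have [dec decP] := nat_codes_prefixes.
pose child (st : seq nat * seq nat) k :=
  (rcons st.1 (dec k 0%N), rcons st.2 (dec k 1%N)).
pose H (st : seq nat * seq nat) := D st.1 `*` E st.2.
have <- : H ([::], [::]) = A1 `*` A2 by rewrite /H /= D0 E0.
apply: (@suslin_tree _ _ _ _ child H).
- move=> [s t] [x y] [/= /Dcov[k _ xk] /Ecov[l _ yl]].
  have [i iP] := decP 1%N (fun n => if n is 0%N then k else l).
  by exists i => //; split; rewrite /= iP.
- by move=> [s t] k [x y] [/= /Dsub ? /Esub].
- move=> p p0 pS.
  have b1 : branch (fun j => (p j).1).
    split; first by rewrite p0.
    by move=> j; have [k ->] := pS j; eexists.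
  have b2 : branch (fun j => (p j).2).
    split; first by rewrite p0.
    by move=> j; have [k ->] := pS j; eexists.
  have [[j Dj]|[a Aa aP]] := Dsh _ b1.
    by left; exists j; rewrite /= /H (Dj : D (p j).1 = set0) set0X.
  have [[j Ej]|[b Ab bP]] := Esh _ b2.
    by left; exists j; rewrite /= /H (Ej : E (p j).2 = set0) setX0.
  right; exists (a, b); first by split; rewrite /= ?D0 ?E0.
  move=> B [[C UC <-] /= /(aP _ UC)[j jC]|[C UC <-] /= /(bP _ UC)[j jC]];
    by exists j => -[x y] [/= hx hy]; exact: jC.
Qed.

Lemma lusin_class_prod d1 d2 (T1 : measurableType d1) (T2 : measurableType d2)
    (U1 : set (set T1)) (U2 : set (set T2)) :
  lusin_class U1 -> lusin_class U2 -> lusin_class (prod_class U1 U2).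
Proof.
move=> [mU1 sU1 S1] [mU2 sU2 S2].
have sepU : separates_points (prod_class U1 U2).
  move=> [a1 a2] [b1 b2] ab.
  have [e1|/sU1[A [B [UA UB Aa Bb AB]]]] := pselect (a1 = b1).
    have /sU2[A [B [UA UB Aa Bb AB]]] : a2 <> b2 by move=> e2; rewrite e1 e2 in ab.
    exists (snd @^-1` A), (snd @^-1` B); split=> //.
    - by right; exists A.
    - by right; exists B.
    - by rewrite -preimage_setI AB preimage_set0.
  exists (fst @^-1` A), (fst @^-1` B); split=> //.
  - by left; exists A.
  - by left; exists B.
  - by rewrite -preimage_setI AB preimage_set0.
split => //.
- move=> _ [[A /mU1 mA <-]|[A /mU2 mA <-]].
    by rewrite -[X in measurable X]setTI; exact: measurable_fst.
  by rewrite -[X in measurable X]setTI; exact: measurable_snd.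
- have sT : suslin (prod_class U1 U2) setT.
    by rewrite -setXTT; apply: suslin_setX; [exact: S1|exact: S2].
  have sC := suslin_sigma_algebra sepU sT.
  suff H : @measurable _ (T1 * T2)%type `<=`
      [set A | suslin (prod_class U1 U2) A /\ suslin (prod_class U1 U2) (~` A)].
    by move=> A /H[].
  apply: smallest_sub => // _ [] [A mA <-]; rewrite setTI.
    split; first by rewrite -setXT; apply: suslin_setX; [exact: S1|exact: S2].
    by rewrite preimage_setC -setXT; apply: suslin_setX; [apply/S1/measurableC|exact: S2].
  split; first by rewrite -setTX; apply: suslin_setX; [exact: S1|exact: S2].
  by rewrite preimage_setC -setTX; apply: suslin_setX; [exact: S1|apply/S2/measurableC].
Qed.

(** * Separation by rectangles *)

Section novikov.
Context T d (S : measurableType d) (p : T -> S) (O : nat -> set T).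

Definition rectangle_separable (E : set T) (C : nat -> set S) :=
  exists B : nat -> set S, [/\ forall n, measurable (B n),
    forall n, B n `&` C n = set0 & E `<=` \bigcup_n (O n `&` p @^-1` B n)].

Lemma rectangle_separable_sub E E' C C' : E `<=` E' ->
  (forall n, C n `<=` C' n) ->
  rectangle_separable E' C' -> rectangle_separable E C.
Proof.
move=> EE' CC' [B [mB BC EB]]; exists B; split => //; last exact: subset_trans EB.
by move=> n; rewrite -subset0 -(BC n); exact: setIS.
Qed.

Lemma rectangle_separable_bigcup (E : nat -> set T) C :
  (forall k, rectangle_separable (E k) C) -> rectangle_separable (\bigcup_k E k) C.
Proof.
move=> /choice[B BP]; exists (fun n => \bigcup_k B k n); split.
- by move=> n; apply: bigcupT_measurable => k; have [] := BP k.
- move=> n; rewrite setI_bigcupl bigcup0 // => k _.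
  by have [_ ->] := BP k.
- move=> x [k _ Ex]; have [_ _ /(_ x Ex)[n _ [On Bn]]] := BP k.
  by exists n => //; split => //; exists k.
Qed.

(** Separating from each piece of [C m] suffices: the new [m]-th set is the
intersection of the old ones and every other set is a union. A point of [E]
that is covered at no index other than [m] is covered at index [m] by all the
old families, hence by the intersection. *)
Lemma rectangle_separable_split E (C : nat -> set S) m (C' : nat -> nat -> set S) :
  (forall k n, n != m -> C' k n = C n) -> C m `<=` \bigcup_k C' k m ->
  (forall k, rectangle_separable E (C' k)) -> rectangle_separable E C.
Proof.
move=> C'C Cm /choice[B BP].
exists (fun n => if n == m then \bigcap_k B k m else \bigcup_k B k n); split.
- move=> n; case: eqP => _.
    by apply: bigcapT_measurable => k; have [] := BP k.
  by apply: bigcupT_measurable => k; have [] := BP k.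
- move=> n; case: eqVneq => [->|nm]; rewrite -subset0.
    move=> y [By /Cm[k _ C'y]]; have [_ /(_ m) <- _] := BP k.
    by split; [exact: By|exact: C'y].
  by move=> y [[k _ By] Cy]; have [_ /(_ n) <- _] := BP k; split; [exact: By|rewrite C'C].
- move=> x Ex.
  have [[k [n [nm On Bn]]]|H] :=
      pselect (exists k n, [/\ n != m, O n x & B k n (p x)]).
    by exists n => //; split => //; rewrite (negbTE nm); exists k.
  have Hk k : O m x /\ B k m (p x).
    have [_ _ /(_ x Ex)[n _ [On Bn]]] := BP k.
    have [nm|nm] := eqVneq n m; first by rewrite -nm.
    by case: H; exists k, n.
  by exists m => //; rewrite eqxx; split; [case: (Hk 0%N)|move=> k _; case: (Hk k)].
Qed.

Lemma rectangle_separable1 E C n V : measurable V -> V `&` C n = set0 ->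
  E `<=` O n -> E `<=` p @^-1` V -> rectangle_separable E C.
Proof.
move=> mV VC EO EV; exists (fun k => if k == n then V else set0); split.
- by move=> k; case: ifP.
- by move=> k; case: eqP => [->|_] //; rewrite set0I.
- by move=> x Ex; exists n => //; rewrite eqxx; split; [exact: EO|exact: EV].
Qed.

(** This contains the theorem of Kunugi and Novikov. If separation fails, it keeps failing when
the set [E] and the sets [C n] are replaced by suitable pieces of their schemes.
As in [suslin_bigcap], the scheme of [C n] is started at step [n]. The branch of
[E] shrinks to a point [x]; choose [n] with [x] in [O n] and [p x] outside [C n].
The branch of [C n] dies out or shrinks to a point other than [p x]; in both
cases a single rectangle separates the pieces at a late step, a contradiction. *)
Lemma suslin_rectangle_separable (U : set (set T)) (V : set (set S)) E C :
  (forall n, U (O n)) -> (forall A, V A -> U (p @^-1` A)) ->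
  V `<=` measurable -> separates_points V ->
  suslin U E -> (forall n, suslin V (C n)) ->
  (forall x, E x -> exists2 n, O n x & ~ C n (p x)) ->
  rectangle_separable E C.
Proof.
move=> UO Up mV sepV [D [D0 Dcov Dsub Dsh]] /choice[F FP] EOC.
have [F0 Fcov Fsub Fsh] : [/\ forall n, F n [::] = C n,
    forall n s, F n s `<=` \bigcup_k F n (rcons s k),
    forall n s k, F n (rcons s k) `<=` F n s &
    forall n v, branch v -> shrinks_into V (F n \o v) (C n)].
  by split => n; have [] := FP n.
apply: contrapT => nsep.
pose bad (st : seq nat * (nat -> seq nat)) :=
  ~ rectangle_separable (D st.1) (fun n => F n (st.2 n)).
have step2 s f m : bad (s, f) -> exists f', [/\ bad (s, f'),
    forall n, (n < m)%N -> exists k, f' n = rcons (f n) k &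
    forall n, (m <= n)%N -> f' n = f n].
  move=> bf; elim: m => [|m [f' [bf' f'f f'E]]]; first by exists f.
  (* lengthen the m-th sequence by one step *)
  have [k bk] : exists k, bad (s, fun n => if n == m then rcons (f' n) k else f' n).
    apply: contrapT => /forallNP H; apply: bf'.
    apply: (@rectangle_separable_split _ _ m
      (fun k n => F n (if n == m then rcons (f' n) k else f' n))).
    - by move=> k n /negbTE ->.
    - by rewrite eqxx; exact: Fcov.
    - by move=> k; apply: contrapT; exact: H.
  exists (fun n => if n == m then rcons (f' n) k else f' n); split => // n.
    rewrite ltnS leq_eqVlt; case: eqVneq => [->|_] /=; last exact: f'f.
    by rewrite f'E //; exists k.
  by move=> mn; rewrite gtn_eqF // f'E // ltnW.
have step (jst : nat * (seq nat * (nat -> seq nat))) :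
    exists st', bad jst.2 -> [/\ bad st',
    exists k, st'.1 = rcons jst.2.1 k,
    forall n, (n <= jst.1)%N -> exists k, st'.2 n = rcons (jst.2.2 n) k &
    forall n, (jst.1 < n)%N -> st'.2 n = jst.2.2 n].
  case: jst => j [s f] /=; have [bf|] := pselect (bad (s, f)); last by exists (s, f).
  have [f' [bf' f'f f'E]] := @step2 s f j.+1 bf.
  have [k bk] : exists k, bad (rcons s k, f').
    apply: contrapT => /forallNP H; apply: bf' => /=.
    have := @rectangle_separable_bigcup (fun k => D (rcons s k))
      (fun n => F n (f' n)) (fun k => contrapT (H k)).
    by move=> sep; apply: rectangle_separable_sub sep => // n.
  by exists (rcons s k, f') => _; split => //; exists k.
have [next nextP] := choice step.
pose st := nat_rect (fun=> (seq nat * (nat -> seq nat))%type)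
  ([::], fun=> [::]) (fun j s => next (j, s)).
have bad_st j : bad (st j).
  elim: j => [|j IH]; last by have [] := nextP (j, st j) IH.
  by move=> H; apply: nsep; apply: rectangle_separable_sub H => [|n] /=; rewrite ?D0 ?F0.
have stS j := nextP (j, st j) (bad_st j).
have st2 n j : (j <= n)%N -> (st j).2 n = [::].
  elim: j => [//|j IH] jn; have [_ _ _ /(_ n jn) ->] := stS j; exact/IH/ltnW.
have bD : branch (fun j => (st j).1) by split => // j; have [_] := stS j.
have bF n : branch (fun j => (st (j + n)%N).2 n).
  split; first by rewrite add0n st2.
  by move=> j; have [_ _ + _] := stS (j + n)%N; apply; exact: leq_addl.
have Ddec := scheme_branch_decreasing Dsub bD.
have Fdec n := scheme_branch_decreasing (Fsub n) (bF n).
have [[j Dj]|[x Ex xP]] := Dsh _ bD.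
  apply: (bad_st j); rewrite (Dj : D (st j).1 = set0).
  by exists (fun=> set0); split => // n; rewrite set0I.
have [n On nC] := EOC x Ex.
have [i iO] := xP _ (UO n) On.
have [[j Fj]|[y Cy yP]] := Fsh n _ (bF n).
  apply: (bad_st (maxn i j + n)%N).
  apply: (@rectangle_separable1 _ _ n setT) => //.
    rewrite setTI -subset0 -[X in _ `<=` X]Fj; exact/Fdec/leq_maxr.
  apply: subset_trans iO; apply: Ddec.
  by rewrite (leq_trans (leq_maxl i j)) ?leq_addr.
have /sepV[A [B [VA VB Ax By AB]]] : p x <> y by move=> e; rewrite e in nC.
have [k kA] := xP _ (Up _ VA) Ax.
have [j jB] := yP _ VB By.
apply: (bad_st (maxn (maxn i k) j + n)%N).
apply: (@rectangle_separable1 _ _ n A) => //; first exact: mV.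
- rewrite -subset0 -AB; apply: setIS; apply: subset_trans jB.
  exact/Fdec/leq_maxr.
- apply: subset_trans iO; apply: Ddec.
  by rewrite (leq_trans (leq_maxl i k)) // (leq_trans (leq_maxl _ j)) ?leq_addr.
- apply: subset_trans kA; apply: Ddec.
  by rewrite (leq_trans (leq_maxr i k)) // (leq_trans (leq_maxl _ j)) ?leq_addr.
Qed.

End novikov.

(** * Standard Borel spaces *)

Lemma lusin_class_preimage d1 d2 (T1 : measurableType d1) (T2 : measurableType d2)
    (f : T1 -> T2) (g : T2 -> T1) (U : set (set T2)) :
  cancel f g -> cancel g f ->
  measurable_fun setT f -> measurable_fun setT g ->
  lusin_class U -> lusin_class [set f @^-1` A | A in U].
Proof.
move=> fK gK mf mg [mU sepU sU]; split.
- by move=> _ [A /mU mA <-]; rewrite -[X in measurable X]setTI; exact: mf.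
- move=> a b ab.
  have /sepU[A [B [UA UB Aa Bb AB]]] : f a <> f b by move=> /(can_inj fK).
  exists (f @^-1` A), (f @^-1` B); split => //.
  + by exists A.
  + by exists B.
  + by rewrite -preimage_setI AB preimage_set0.
- move=> A mA.
  have -> : A = g @` (g @^-1` A).
    rewrite eqEsubset; split=> [x Ax|_ [y Ay <-] //].
    by exists (f x) => //=; rewrite fK.
  apply: (@suslin_image _ _ U) => [_ [B UB <-]|].
    by rewrite -comp_preimage (_ : f \o g = id) //; apply/funext => y /=.
  by apply: sU; rewrite -[X in measurable X]setTI; exact: mg.
Qed.

Lemma lusin_class_tuple d (X : measurableType d) (U : set (set X)) (r : nat) :
  lusin_class U -> exists V : set (set (r.-tuple X)), lusin_class V.
Proof.
move=> lU; elim: r => [|r [V lV]].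
  exists set0; split => //.
    by move=> a b; rewrite (tuple0 a) (tuple0 b).
  move=> A _; exists (fun=> A); split;
    [by []|by move=> s a Aa; exists 0%N|by move=> s k x|move=> v _].
  have [->|/set0P[a Aa]] := eqVneq A set0; first by left; exists 0%N.
  by right; exists a.
pose f (t : r.+1.-tuple X) : X * r.-tuple X := (thead t, [tuple of behead t]).
pose g (p : X * r.-tuple X) : r.+1.-tuple X := [tuple of p.1 :: p.2].
exists [set f @^-1` A | A in prod_class U V].
apply: (@lusin_class_preimage _ _ _ _ f g).
- by move=> t; rewrite /f /g /= -tuple_eta.
- by move=> [x t]; rewrite /f /g /= theadE; congr pair; apply: val_inj.
- apply/measurable_fun_pair; first exact: measurable_tnth.
  exact: measurable_behead.
- exact: measurable_cons.
- exact: lusin_class_prod.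
Qed.

Lemma second_countable_sequence (T : topologicalType) : @second_countable T ->
  exists B : nat -> set T, (forall k, open (B k)) /\
    forall x V, nbhs x V -> exists k, B k x /\ B k `<=` V.
Proof.
move=> [BB /countable_injP[e einj] [Bo Bb]].
exists (fun k => \bigcup_(W in [set W | BB W /\ e W = k]) W); split.
  by move=> k; apply: bigcup_open => W [BW _]; exact: Bo.
move=> x V /Bb[W [BW Wx] WV]; exists (e W); split; first by exists W.
by move=> y [W' [BW' /einj]]; rewrite !inE => -> //; exact: WV.
Qed.

(** Completeness in terms of a sequence of notions of smallness in place of a
metric. It covers complete metric spaces, where the [i]-th small sets are those
inside a ball of radius 1/(i+1), and also locally compact spaces, without the
choice of a metric. *)
Definition refining_complete (T : topologicalType) (small : nat -> set (set T)) :=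
  (forall i (x : T), exists2 V, nbhs x V & forall W, W `<=` V -> small i W) /\
  forall D : nat -> set T, (forall j, D j.+1 `<=` D j) ->
    (forall j, D j !=set0) ->
    (forall i, exists2 W, small i W & D i.+1 `<=` W) ->
    exists a : T, forall V, nbhs a V -> exists j, D j `<=` V.

(** The nodes of the scheme intersect [F] with small basic open sets. *)
Lemma suslin_closed (T : topologicalType) (small : nat -> set (set T)) (F : set T) :
  @second_countable T -> refining_complete small -> closed F -> suslin open F.
Proof.
move=> /second_countable_sequence[B [Bo Bn]] [smallV cpl] cF.
pose D (s : seq nat) := [set x | F x /\ forall i, (i < size s)%N ->
  small i (B (nth 0%N s i)) /\ B (nth 0%N s i) x].
have Dsub s k : D (rcons s k) `<=` D s.
  move=> x [Fx Dx]; split => // i si.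
  by have := Dx i; rewrite size_rcons nth_rcons si ltnS ltnW //; exact.
exists D; split => //.
- by rewrite eqEsubset; split => x; [case|split].
- move=> s x [Fx Dx].
  have [V /Bn[k [Bkx /[swap] /[apply] sk]]] := smallV (size s) x.
  exists k => //; split => // i; rewrite size_rcons ltnS leq_eqVlt nth_rcons.
  by case: eqVneq => [->|_ /= si]; [rewrite ltnn|rewrite si; exact: Dx].
- move=> v bv; have [v0 vS] := bv.
  have size_v j : size (v j) = j.
    by elim: j => [|j IH]; [rewrite v0|have [k ->] := vS j; rewrite size_rcons IH].
  have [[j Dj]|/forallNP Dne] := pselect (exists j, D (v j) = set0).
    by left; exists j.
  have Dj j : D (v j) !=set0 by apply/set0P/eqP; exact: Dne.
  have DS j : D (v j.+1) `<=` D (v j) by exact: scheme_branch_decreasing.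
  have [|a aP] := cpl (D \o v) DS Dj.
    move=> i; exists (B (nth 0%N (v i.+1) i)).
      by have [x [_ /(_ i)]] := Dj i.+1; rewrite size_v => /(_ (leqnn _))[].
    by move=> x [_ /(_ i)]; rewrite size_v => /(_ (leqnn _))[].
  right; exists a; last by move=> V oV Va; apply: aP; exact: open_nbhs_nbhs.
  apply: cF => V /aP[j jV]; have [x Dx] := Dj j.
  by exists x; split; [case: Dx|exact: jV].
Qed.

(** Closed sets are Suslin, and open sets are countable unions of closures of basic
sets, hence Suslin as well; so all Borel sets are. *)
Lemma lusin_class_open (T : ptopologicalType) (small : nat -> set (set T)) :
  hausdorff_space T -> regular_space T -> @second_countable T ->
  refining_complete small -> @lusin_class _ (borel T) open.
Proof.
move=> hT rT sT cT.
have sepT : separates_points (@open T).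
  move=> a b /eqP ab; move: hT; rewrite open_hausdorff => /(_ a b ab).
  move=> [[A B] /= [/set_mem Aa /set_mem Bb] [oA oB /eqP AB]].
  by exists A, B.
have closed_sus F (cF : closed F) : suslin open F := suslin_closed sT cT cF.
split => //.
  by move=> A oA; exact: sub_sigma_algebra.
suff H : @measurable _ (borel T) `<=`
    [set A | suslin (@open T) A /\ suslin (@open T) (~` A)].
  by move=> A /H[].
apply: smallest_sub => [|A oA]; first exact/suslin_sigma_algebra/closed_sus/closedT.
split; last exact/closed_sus/open_closedC.
have [B [Bo Bn]] := second_countable_sequence sT.
rewrite (_ : A = \bigcup_k if `[< closure (B k) `<=` A >] then closure (B k) else set0).
  apply: suslin_bigcup => k; case: ifP => _; last exact: suslin0.
  exact/closed_sus/closed_closure.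
rewrite eqEsubset; split => x; last by move=> [k _]; case: asboolP => // + ?; exact.
move=> Ax; have [V /Bn[k [Bx BV]] VA] : filter_from (nbhs x) closure A.
  by apply: rT; exact: open_nbhs_nbhs.
exists k => //; case: asboolP => [_|[]]; first exact: subset_closure.
by apply: subset_trans VA; exact: closureS.
Qed.

Lemma decreasing_filter T (D : nat -> set T) :
  (forall j, D j.+1 `<=` D j) -> (forall j, D j !=set0) ->
  ProperFilter (filter_from [set: nat] D).
Proof.
move=> /decreasing_chain Ddec Dne.
apply: filter_from_proper => //; apply: filter_from_filter; first by exists 0%N.
move=> i j _ _; exists (maxn i j) => //.
by rewrite subsetI; split; apply: Ddec; rewrite ?leq_maxl ?leq_maxr.
Qed.

Lemma lusin_class_polish (R : realType) (P : completePseudoMetricType R) :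
  hausdorff_space P -> @second_countable P -> @lusin_class _ (borel P) open.
Proof.
move=> hP sP.
apply: (@lusin_class_open _ (fun i => [set W | exists x : P, W `<=` ball x i.+1%:R^-1])) => //.
  exact: uniform_regular.
split.
  move=> i x; exists (ball x i.+1%:R^-1); last by move=> W Wx; exists x.
  by apply: nbhsx_ballx; rewrite invr_gt0.
move=> D DS Dne Dsmall.
pose FF := filter_from [set: nat] D.
have FFF : ProperFilter FF by exact: decreasing_filter.
have /cauchy_cvg : cauchy FF.
  apply: cauchy_exP => e e0.
  have [i ie] : exists i, i.+1%:R^-1 < e.
    near \oo => i; exists i; near: i; exact: near_infty_natSinv_lt (PosNum e0).
  have [W [x Wx] DW] := Dsmall i.
  exists x; exists i.+1 => //; apply: subset_trans DW _; apply: subset_trans Wx _.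
  by apply: le_ball; exact: ltW.
move=> /cvg_ex[a FFa]; exists a => V /FFa[j _ jV]; by exists j.
Unshelve. all: by end_near. Qed.

Lemma lusin_class_standard_borel (R : realType) d (X : measurableType d) :
  standard_borel R X -> exists U : set (set X), lusin_class U.
Proof.
move=> [P [f [hP sP [g fK gK] mX]]].
exists [set f @^-1` A | A in open].
apply: (@lusin_class_preimage _ _ X (borel P) f g) => //.
- by move=> _ A mA; rewrite mX; exists A.
- move=> _ A; rewrite setTI mX => -[B mB <-].
  by rewrite setTI -comp_preimage (_ : f \o g = id) //; apply/funext => y /=.
- exact: lusin_class_polish.
Qed.

Lemma locally_compact_nbhs (T : topologicalType) : locally_compact [set: T] ->
  forall x : T, exists2 K, nbhs x K & compact K.
Proof.
move=> lT x; have [K Kx [cK _]] := lT x I; exists K => //.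
by move: Kx; rewrite withinET.
Qed.

(** The small sets lie in a compact set, which yields a cluster point [a] of a
decreasing sequence of such sets. If the [i]-th pair of basic open sets has the
closure of [B k] inside [B l], the [i]-th small sets lie in [B l] or avoid [B k]. Given a
neighbourhood of [a], pick such a pair with [a] in [B k] and [B l] inside the
neighbourhood: the sequence cannot avoid [B k], so it ends up in [B l]. *)
Lemma lusin_class_locally_compact (T : ptopologicalType) :
  hausdorff_space T -> locally_compact [set: T] -> @second_countable T ->
  @lusin_class _ (borel T) open.
Proof.
move=> hT lT sT; have lcT := locally_compact_nbhs lT.
have rT : regular_space T.
  by move=> x; have [K Kx cK] := lcT x; exact: compact_regular Kx.
have [B [Bo Bn]] := second_countable_sequence sT.
pose small (i : nat) := [set W | (exists2 K, compact K & W `<=` K) /\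
  forall k l, unpickle i = Some (k, l) -> closure (B k) `<=` B l ->
    W `<=` B l \/ W `&` B k = set0].
apply: (@lusin_class_open _ small) => //; split.
  move=> i x; have [K Kx cK] := lcT x.
  case E : (unpickle i : option (nat * nat)) => [[k l]|]; last first.
    by exists K => // W WK; split; [exists K|move=> k l; rewrite E].
  have [kl|nkl] := pselect (closure (B k) `<=` B l); last first.
    exists K => // W WK; split; first by exists K.
    by move=> k' l'; rewrite E => -[<- <-].
  have [xk|nxk] := pselect (closure (B k) x).
    exists (K `&` B l);
      first by apply: filterI => //; exact: open_nbhs_nbhs (conj (Bo l) (kl _ xk)).
    move=> W WK; split; first by exists K => // y /WK[].
    by move=> k' l'; rewrite E => -[<- <-] _; left => y /WK[].
  exists (K `&` ~` closure (B k)).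
    apply: filterI => //; apply: open_nbhs_nbhs; split => //.
    exact/closed_openC/closed_closure.
  move=> W WK; split; first by exists K => // y /WK[].
  move=> k' l'; rewrite E => -[<- <-] _; right; rewrite -subset0 => y [/WK[_ ny] By].
  exact/ny/subset_closure.
move=> D DS Dne Dsmall.
pose FF := filter_from [set: nat] D.
have FFF : ProperFilter FF by exact: decreasing_filter.
have [W [[K cK WK] _] DW] := Dsmall 0%N.
have [a [Ka aF]] := cK FF FFF (ex_intro2 _ _ 1%N I (subset_trans DW WK)).
exists a => V /Bn[l [Bla BlV]].
have [V' /Bn[k [Bka kV']] V'l] : filter_from (nbhs a) closure (B l).
  by apply: rT; exact: open_nbhs_nbhs.
have kl : closure (B k) `<=` B l by apply: subset_trans V'l; exact: closureS.
have [W' [_ W'kl] DW'] := Dsmall (pickle (k, l)).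
exists (pickle (k, l)).+1.
have [W'l|W'k] := W'kl k l (pickleK _) kl.
  by apply: subset_trans DW' _; exact: subset_trans BlV.
have [||z [Dz Bz]] := aF (D (pickle (k, l)).+1) (B k).
- by exists (pickle (k, l)).+1.
- by apply: open_nbhs_nbhs; split.
- have : (W' `&` B k) z by split => //; exact: DW'.
  by rewrite W'k.
Qed.

Lemma open_measurable_borel (T : ptopologicalType) (A : set T) :
  open A -> @measurable _ (borel T) A.
Proof. by move=> oA; exact: sub_sigma_algebra. Qed.

Lemma compact_measurable_borel (T : ptopologicalType) (K : set T) :
  hausdorff_space T -> compact K -> @measurable _ (borel T) K.
Proof.
move=> hT /(compact_closed hT) cK; rewrite -[K]setCK; apply: measurableC.
apply: open_measurable_borel; exact: closed_openC.
Qed.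

Lemma sigma_compact (T : topologicalType) :
  locally_compact [set: T] -> @second_countable T ->
  exists K : nat -> set T, (forall n, compact (K n)) /\ \bigcup_n K n = setT.
Proof.
move=> lT /second_countable_sequence[B [_ Bn]]; have lcT := locally_compact_nbhs lT.
have /choice[K KP] k : exists K, compact K /\
    ((exists2 K', compact K' & B k `<=` K') -> B k `<=` K).
  have [[K' cK' BK']|H] := pselect (exists2 K', compact K' & B k `<=` K').
    by exists K'.
  by exists set0; split => //; exact: compact0.
exists K; split; first by move=> n; have [] := KP n.
rewrite -subTset => x _; have [K' K'x cK'] := lcT x.
have [k [Bkx BK']] := Bn x K' K'x.
by exists k => //; have [_] := KP k; apply => //; exists K'.
Qed.

(** * Projections along a locally compact space *)

Section projection.
Context (T : ptopologicalType) d (S : measurableType d) (V : set (set S)).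
Hypotheses (hT : hausdorff_space T) (lT : locally_compact [set: T])
  (sT : @second_countable T) (lV : lusin_class V).

(** The complement of [A] has open sections, so it is a countable union of
rectangles [B n `*` W n] with [B n] open and [W n] measurable, by
[suslin_rectangle_separable]. A point [s] is outside the projection if and only
if the sets [B n] with [s] in [W n] cover [K], and by compactness finitely many
of them do: this is a countable condition. *)
Lemma measurable_proj_compact (K : set T) (A : set (borel T * S)) :
  compact K -> measurable A -> A `<=` fst @^-1` K ->
  (forall s, closed (ysection A s : set T)) -> measurable (snd @` A).
Proof.
move=> cK mA AK cA.
have [B [Bo Bn]] := second_countable_sequence sT.
have lT' := lusin_class_locally_compact hT lT sT.
have [mV sepV _] := lV.
have [_ _ susU] := lusin_class_prod lT' lV.
(* s is outside C n when B n lies in the complement of the section of A at s *)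
pose C n := snd @` (A `&` fst @^-1` B n).
have [|||||||W [mW WC AW]] := @suslin_rectangle_separable (borel T * S)%type _ S snd
    (fun n => fst @^-1` B n) (prod_class open V) V (~` A) C.
- by move=> n; left; exists (B n).
- by move=> X VX; right; exists X.
- exact: mV.
- exact: sepV.
- exact/susU/measurableC.
- move=> n; apply: (@suslin_image _ _ (prod_class open V)).
    by move=> X VX; right; exists X.
  apply/susU/measurableI => //; rewrite -[X in measurable X]setTI.
  by apply: measurable_fst => //; exact: open_measurable_borel.
- move=> [g s] nA; have [n [Bng BnA]] : exists n, B n g /\ B n `<=` ~` ysection A s.
    apply: Bn; apply: open_nbhs_nbhs; split; first exact/closed_openC.
    by rewrite /ysection /= inE.
  exists n => //= -[[g' s'] [Ag /= Bg] e]; apply: (BnA g') => //.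
  by rewrite /ysection /= inE -e.
rewrite -[snd @` A]setCK; apply: measurableC.
rewrite (_ : ~` (snd @` A) = \bigcup_(D in (fun D : seq nat =>
   K `<=` cover [set` D] B)) \bigcap_(n in [set` D]) W n).
  rewrite bigcup_mkcond; apply: countable_bigcupT_measurable => // D.
  by case: ifP => // _; apply: fin_bigcap_measurable => //; exact: finite_seq.
rewrite eqEsubset; split => s.
- move=> nAs.
  have [D sD KD] : finite_subset_cover [set n | W n s] B K.
    move: cK; rewrite compact_cover; apply => // g Kg.
    have [|n _ [/= Bng Wns]] := AW (g, s).
      by move=> Ags; apply: nAs; exists (g, s).
    by exists n.
  by exists (finmap.enum_fset D) => // n /= /sD; rewrite inE.
- move=> [D KD WD] [[g s'] Ag /= e]; rewrite {}e in Ag.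
  have [n Dn Bng] := KD g (AK _ Ag).
  have : (W n `&` C n) s by split; [exact: WD|exists (g, s)].
  by rewrite WC.
Qed.
End projection.

(** Images of Borel sets under projections are in general only analytic. Here the
part of [A] above a compact set has finite, hence closed, sections. *)
Lemma measurable_proj_locally_finite (T : ptopologicalType) d
    (S : measurableType d) (V : set (set S)) (A : set (borel T * S)) :
  hausdorff_space T -> locally_compact [set: T] -> @second_countable T ->
  lusin_class V -> measurable A ->
  (forall s, locally_finite (ysection A s : set T)) -> measurable (snd @` A).
Proof.
move=> hT lT sT lV mA fA; have [K [cK KT]] := sigma_compact lT sT.
have -> : snd @` A = \bigcup_n (snd @` (A `&` fst @^-1` K n)).
  rewrite -image_bigcup -setI_bigcupr -preimage_bigcup.
  by have -> : \bigcup_n K n = setT by []; rewrite preimage_setT setIT.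
apply: bigcupT_measurable => n.
apply: (measurable_proj_compact hT lT sT lV (cK n)).
- apply: measurableI => //; rewrite -[X in measurable X]setTI.
  by apply: measurable_fst => //; exact: compact_measurable_borel.
- by move=> x [].
- move=> s; have /accessible_finite_set_closed := hausdorff_accessible hT; apply.
  apply: sub_finite_set (fA s (K n) (cK n)) => g.
  by rewrite /ysection /= !inE => -[].
Qed.

Lemma open_measurable_prod (T1 T2 : ptopologicalType) (A : set (T1 * T2)) :
  @second_countable T1 -> @second_countable T2 -> open A ->
  @measurable _ (borel T1 * borel T2)%type A.
Proof.
move=> /second_countable_sequence[B1 [Bo1 n1]] /second_countable_sequence[B2 [Bo2 n2]] oA.
have -> : A = \bigcup_k \bigcup_l
    if `[< B1 k `*` B2 l `<=` A >] then B1 k `*` B2 l else set0.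
  rewrite eqEsubset; split => [[x y] Axy|p [k _ [l _]]]; last first.
    by case: asboolP => // + Bp; exact.
  have [[V1 V2] /= [/n1 [k [Bx BV1]] /n2 [l [By BV2]]] VA] :
    nbhs (x, y) A by exact: open_nbhs_nbhs.
  exists k => //; exists l => //; case: asboolP => // -[] [a b] [/= ? ?].
  by apply: VA; split; [exact: BV1|exact: BV2].
apply: bigcupT_measurable => k; apply: bigcupT_measurable => l.
case: ifP => // _; apply: (@measurableX _ _ (borel T1) (borel T2)).
  exact: open_measurable_borel.
exact: open_measurable_borel.
Qed.

Lemma continuous_measurable_prod (T1 T2 T3 : ptopologicalType) (f : T1 * T2 -> T3) :
  @second_countable T1 -> @second_countable T2 -> continuous f ->
  measurable_fun setT (f : borel T1 * borel T2 -> borel T3).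
Proof.
move=> s1 s2 cf; apply: (@measurability _ _ _ (borel T3) _ _ (@open T3)) => //.
move=> _ [A oA <-]; rewrite setTI.
apply: open_measurable_prod => //; move/continuousP: cf; exact.
Qed.

Lemma continuous_measurable_borel (T1 T2 : ptopologicalType) (f : T1 -> T2) :
  continuous f -> measurable_fun setT (f : borel T1 -> borel T2).
Proof.
move=> cf; apply: (@measurability _ _ _ (borel T2) _ _ (@open T2)) => //.
move=> _ [A oA <-]; rewrite setTI.
apply: open_measurable_borel; move/continuousP: cf; exact.
Qed.

(** * Voronoi cells *)

Section group_measurability.
Context {G : topologicalGroupType} (hG : lcsc G).

Lemma measurable_mulg d (S : measurableType d) (f g : S -> borel G) :
  measurable_fun setT f -> measurable_fun setT g ->
  measurable_fun setT (fun x => (f x * g x)%g : borel G).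
Proof.
move=> mf mg; have [_ _ sG] := hG.
apply: (@measurableT_comp _ _ _ _ _ _
  (fun p : borel G * borel G => (p.1 * p.2)%g : borel G)
  _ (fun x => (f x, g x))); last exact: measurable_fun_pair.
exact: (continuous_measurable_prod sG sG (@mulg_continuous G)).
Qed.

Lemma measurable_invg d (S : measurableType d) (f : S -> borel G) :
  measurable_fun setT f ->
  measurable_fun setT (fun x => (f x)^-1%g : borel G).
Proof.
move=> mf; apply: (@measurableT_comp _ _ _ _ _ _
  (fun p : borel G => p^-1%g : borel G) _ f) => //.
exact: (continuous_measurable_borel (@invg_continuous G)).
Qed.

End group_measurability.

Lemma finite_set_minimal (T : eqType) (lt : T -> T -> Prop) (A : set T) :
  (forall x, ~ lt x x) -> (forall x y z, lt x y -> lt y z -> lt x z) ->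
  finite_set A -> A !=set0 -> exists2 m, A m & forall x, A x -> ~ lt x m.
Proof.
move=> irr tr /finite_seqP[s ->].
elim: s => [[x //]|a s IH _].
have [s0|/set0P/IH[m sm mP]] := eqVneq [set` s] set0.
  exists a => [|x]; rewrite /= in_cons ?eqxx // => /orP[/eqP -> //|xs].
  by have : [set` s] x by []; rewrite s0.
have [am|nam] := pselect (lt a m).
  exists a => [|x]; rewrite /= in_cons ?eqxx // => /orP[/eqP -> //|xs xa].
  exact: (mP x xs (tr _ _ _ xa am)).
exists m => [|x]; rewrite /= in_cons; first by rewrite sm orbT.
by move=> /orP[/eqP -> //|xs]; exact: mP.
Qed.

Section voronoi.
Context {R : realType} {G : topologicalGroupType}.
Variables (dist : G -> G -> R) (prec : G -> G -> Prop).
Hypotheses (hdist : voronoi_metric dist) (hprec : borel_linear_order prec).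

(** The strict order, depending on [x], for which the points of [P] whose cell
contains [x] are the minimal elements of [P]. It merges the distance and the
tie-breaking order, so that one quantifier over [P] describes the cells. *)
Definition closer (x q p : G) : Prop :=
  dist x q < dist x p \/
  (dist x q = dist x p /\ prec (x * q^-1)%g (x * p^-1)%g).

Lemma closer_irr x p : ~ closer x p p.
Proof.
by move=> [|[_]]; [rewrite ltxx|case: hprec => + _ _ _; apply].
Qed.

Lemma closer_trans x p q s : closer x p q -> closer x q s -> closer x p s.
Proof.
have [_ tr _ _] := hprec.
move=> [pq|[pq ppq]] [qs|[qs pqs]].
- by left; exact: lt_trans qs.
- by left; rewrite -qs.
- by left; rewrite pq.
- by right; split; [rewrite pq|exact: tr pqs].
Qed.

Lemma closer_total x p q : p <> q -> closer x p q \/ closer x q p.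
Proof.
move=> pq; have [_ _ tot _] := hprec.
have [lt|lt|e] := ltgtP (dist x p) (dist x q); [by left; left|by right; left|].
have /tot[?|?] : (x * p^-1)%g <> (x * q^-1)%g.
- by move=> /mulgI/invg_inj.
- by left; right.
- by right; right.
Qed.

Lemma closer_mulg x p q g : closer (x * g)%g (p * g)%g (q * g)%g = closer x p q.
Proof.
have [_ inv _ _] := hdist.
by rewrite /closer !inv !mulgKA.
Qed.

Lemma voronoi_cellP (P : set G) p x :
  voronoi_cell dist prec P p x <-> P p /\ forall q, P q -> ~ closer x q p.
Proof.
have [[d0 _ _ _] _ _ _] := hdist; have [irr tr tot _] := hprec.
have lb : has_lbound [set dist x q | q in P].
  by exists 0 => _ [q _ <-].
split=> [[[Pp dp] [_ minp]]|[Pp H]].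
  split => // q Pq [|[e prec_qp]]; first by rewrite ltNge dp ge_inf //; exists q.
  have [e'|ne] := pselect ((x * q^-1)%g = (x * p^-1)%g).
    by apply: (irr (x * p^-1)%g); rewrite -{1}e'.
  apply: (irr (x * p^-1)%g); apply: tr prec_qp; apply: minp => //.
  by exists q => //; split => //; rewrite e.
have le q : P q -> dist x p <= dist x q.
  by move=> Pq; rewrite leNgt; apply/negP => lt; apply: (H q Pq); left.
have dp : dist x p = inf [set dist x q | q in P].
  apply/eqP; rewrite eq_le; apply/andP; split.
    by apply: lb_le_inf; [exists (dist x p), p|move=> _ [q Pq <-]; exact: le].
  by apply: ge_inf => //; exists p.
have np : nearest dist x P p by split.
split => //; split; first by exists p.
move=> _ [q [Pq dq] <-] /tot[pq|//].
by case: (H q Pq); right; rewrite dq -dp.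
Qed.

(** Only the points of [P] in a closed ball around [x] compete; by properness of
the metric there are finitely many of them. *)
Lemma exists_voronoi_cell (P : set G) x : locally_finite P -> P !=set0 ->
  exists2 p, P p & voronoi_cell dist prec P p x.
Proof.
move=> fP [p0 Pp0]; have [_ _ cb _] := hdist.
suff [m [Pm mp0] mP] : exists2 m, (P `&` [set q | dist x q <= dist x p0]) m &
    forall q, (P `&` [set q | dist x q <= dist x p0]) q -> ~ closer x q m.
  exists m => //; apply/voronoi_cellP; split => // q Pq qm.
  have [le|lt] := leP (dist x q) (dist x p0); first exact: (mP q).
  case: qm => [qm|[e _]]; last by move: mp0; rewrite /= -e leNgt lt.
  by have := lt_trans lt (lt_le_trans qm mp0); rewrite ltxx.
apply: finite_set_minimal; [exact: closer_irr|exact: closer_trans|exact: fP|].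
by exists p0; split => /=.
Qed.

Lemma voronoi_cell_uniq (P : set G) p q x :
  voronoi_cell dist prec P p x -> voronoi_cell dist prec P q x -> p = q.
Proof.
move=> /voronoi_cellP[Pp Hp] /voronoi_cellP[Pq Hq]; apply: contrapT.
by move=> /(closer_total x)[]; [exact: Hq|exact: Hp].
Qed.

Lemma voronoi_cell_mulg (P Q : set G) p x g :
  (forall q, Q (q * g)%g <-> P q) ->
  voronoi_cell dist prec Q (p * g)%g (x * g)%g <-> voronoi_cell dist prec P p x.
Proof.
move=> QP; rewrite !voronoi_cellP QP; split=> -[Pp H]; split => // q.
  by move=> /QP Qq; rewrite -(closer_mulg _ _ _ g); exact: H.
by rewrite -[q](mulgVK g) closer_mulg => /QP; exact: H.
Qed.
End voronoi.

(** * Fubini's theorem for sections *)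

(** The sigma-finiteness of a measure is part of a structure inferred from its
name; this copy lets a hypothesis provide it. *)
Definition sigma_finite_copy d (T : measurableType d) (R : realType)
  (m : {measure set T -> \bar R}) (s : sigma_finite setT m) (A : set T) := m A.

Section sigma_finite_copy.
Context d (T : measurableType d) (R : realType)
  (m : {measure set T -> \bar R}) (s : sigma_finite setT m).

Let m0 : sigma_finite_copy s set0 = 0%E.
Proof. exact: measure0. Qed.

Let m_ge0 A : (0 <= sigma_finite_copy s A)%E.
Proof. exact: measure_ge0. Qed.

Let m_sigma_additive : semi_sigma_additive (sigma_finite_copy s).
Proof. exact: (@measure_semi_sigma_additive _ _ _ m). Qed.

HB.instance Definition _ :=
  @isMeasure.Build _ _ _ (sigma_finite_copy s) m0 m_ge0 m_sigma_additive.
HB.instance Definition _ :=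
  @Measure_isSigmaFinite.Build _ _ _ (sigma_finite_copy s) s.

End sigma_finite_copy.

Lemma fubini_sections d1 d2 (T1 : measurableType d1) (T2 : measurableType d2)
    (R : realType) (m1 : {measure set T1 -> \bar R})
    (m2 : {measure set T2 -> \bar R}) (A : set (T1 * T2)) :
  sigma_finite setT m1 -> sigma_finite setT m2 -> measurable A ->
  (\int[m1]_x m2 (xsection A x) = \int[m2]_y m1 (ysection A y))%E.
Proof.
move=> s1 s2 mA.
have := @indic_fubini_tonelli _ _ _ _ _ (sigma_finite_copy s1)
  (sigma_finite_copy s2) A mA.
by rewrite indic_fubini_tonelli_FE // indic_fubini_tonelli_GE.
Qed.

Lemma measurable_fun_measure_ysection d1 d2 (T1 : measurableType d1)
    (T2 : measurableType d2) (R : realType) (m1 : {measure set T1 -> \bar R})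
    (A : set (T1 * T2)) : sigma_finite setT m1 -> measurable A ->
  measurable_fun setT (fun y => m1 (ysection A y)).
Proof.
move=> s1 mA.
exact: (@measurable_fun_ysection _ _ _ _ _ (sigma_finite_copy s1) A mA).
Qed.

Lemma measurable_preimage d1 d2 (T1 : measurableType d1) (T2 : measurableType d2)
    (f : T1 -> T2) (A : set T2) :
  measurable_fun setT f -> measurable A -> measurable (f @^-1` A).
Proof. by move=> mf mA; rewrite -[X in measurable X]setTI; exact: mf. Qed.

Lemma measurable_metric (R : realType) (G : topologicalGroupType)
    (dist : G -> G -> R) (hG : lcsc G) (hdist : voronoi_metric dist) :
  measurable_fun setT (fun p : borel G * borel G => dist p.1 p.2).
Proof.
have [_ _ sG] := hG; have [[_ _ dC dT] _ _ dnbhs] := hdist.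
apply: (@measurability _ _ _ _ _ _ _ (RGenOInfty.measurableE R)) => //.
move=> _ [_ [t ->] <-]; rewrite setTI; apply: open_measurable_prod => //.
rewrite openE => -[x y] /=; rewrite in_itv /= andbT => txy.
pose e := (dist x y - t) / 2.
have e0 : 0 < e by rewrite /e; lra.
exists ([set z | dist x z < e], [set z | dist y z < e]).
  by split; apply/dnbhs; exists e.
move=> [a b] [/= xa yb]; rewrite /= in_itv /= andbT.
have := dT x a y; have := dT a b y; rewrite (dC b y) => h1 h2.
by move: xa yb; rewrite /e; lra.
Qed.

(** * Measurability of cells and saturations *)

Section voronoi_measurability.
Context {R : realType} {G : topologicalGroupType} (hG : lcsc G).
Context d (Z : measurableType d) (V : set (set Z)) (lV : lusin_class V).
Variables (act : G -> Z -> Z) (Y : set Z).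
Hypotheses (mact : measurable_fun [set: borel G * Z]
  (fun gz : borel G * Z => act gz.1 gz.2))
  (mY : measurable Y) (finY : forall z, locally_finite (return_set act Y z)).
Variables (dist : G -> G -> R) (prec : G -> G -> Prop).
Hypotheses (hdist : voronoi_metric dist) (hprec : borel_linear_order prec).

Lemma measurable_return_set d' (S : measurableType d') (f : S -> borel G) (z : S -> Z) :
  measurable_fun setT f -> measurable_fun setT z ->
  measurable [set s | return_set act Y (z s) (f s)].
Proof.
move=> mf mz; apply: (@measurable_preimage _ _ _ _ (fun s => act (f s) (z s))) => //.
apply: (@measurableT_comp _ _ _ _ _ _ (fun gz : borel G * Z => act gz.1 gz.2)
  _ (fun s => (f s, z s))) => //.
exact: measurable_fun_pair.
Qed.

Lemma measurable_closer d' (S : measurableType d') (x q p : S -> borel G) :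
  measurable_fun setT x -> measurable_fun setT q -> measurable_fun setT p ->
  measurable [set s | closer dist prec (x s) (q s) (p s)].
Proof.
move=> mx mq mp; have [_ _ _ mprec] := hprec.
have mdist (f g : S -> borel G) : measurable_fun setT f -> measurable_fun setT g ->
    measurable_fun setT (fun s => dist (f s) (g s)).
  move=> mf mg; apply: (@measurableT_comp _ _ _ _ _ _
    (fun p : borel G * borel G => dist p.1 p.2) _ (fun s => (f s, g s))).
    exact: measurable_metric.
  exact: measurable_fun_pair.
have mlt := @measurable_fun_ltr _ _ _ _ _ _ (mdist _ _ mx mq) (mdist _ _ mx mp).
have meq := @measurable_fun_eqr _ _ _ _ _ _ (mdist _ _ mx mq) (mdist _ _ mx mp).
rewrite (_ : mkset _ =
  ((fun s => dist (x s) (q s) < dist (x s) (p s)) @^-1` [set true]) `|`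
  (((fun s => dist (x s) (q s) == dist (x s) (p s)) @^-1` [set true]) `&`
   ((fun s => ((x s * (q s)^-1)%g : borel G, (x s * (p s)^-1)%g : borel G)) @^-1`
     [set gh : borel G * borel G | prec gh.1 gh.2]))).
  apply: measurableU; first exact: measurable_preimage mlt _.
  apply: measurableI; first exact: measurable_preimage meq _.
  apply: measurable_preimage => //; apply: measurable_fun_pair.
    by apply: measurable_mulg => //; exact: measurable_invg.
  by apply: measurable_mulg => //; exact: measurable_invg.
rewrite eqEsubset; split => s; rewrite /closer /=.
  by move=> [->|[/eqP -> ?]]; [left|right].
by move=> [->|[/eqP -> ?]]; [left|right].
Qed.

Definition cell_graph : set (borel G * (borel G * Z)) :=
  [set p | voronoi_cell dist prec (return_set act Y p.2.2) p.1 p.2.1].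

Lemma lusin_class_group : @lusin_class _ (borel G) open.
Proof. by have [? ? ?] := hG; exact: lusin_class_locally_compact. Qed.

(** The sections of [A] are locally finite, being contained in return sets. *)
Lemma measurable_group_proj d' (S : measurableType d') (U : set (set S))
    (A : set (borel G * S)) (z : S -> Z) :
  lusin_class U -> measurable A ->
  (forall g s, A (g, s) -> return_set act Y (z s) g) ->
  measurable [set s | exists g, A (g, s)].
Proof.
move=> lU mA Asub; have [hh lh sh] := hG.
rewrite (_ : mkset _ = snd @` A); last first.
  rewrite eqEsubset; split => s; first by move=> [g Ag]; exists (g, s).
  by move=> [[g t] Ag <-]; exists g.
apply: (measurable_proj_locally_finite hh lh sh lU mA) => s K cK.
apply: sub_finite_set (finY (z s) cK); apply: setSI => g.
by rewrite /ysection /= inE => /Asub.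
Qed.

(** A point [g] of the return set of [z] fails to have [h] in its cell when some
other point [q] of the return set is closer to [h]. The pairs with this property
project along [q] onto the failing triples, with locally finite sections. *)
Lemma measurable_cell_graph : measurable cell_graph.
Proof.
have mg2 : measurable_fun setT (fun p : borel G * (borel G * (borel G * Z)) => p.2.1).
  exact: measurableT_comp.
have mh2 : measurable_fun setT (fun p : borel G * (borel G * (borel G * Z)) => p.2.2.1).
  by apply: measurableT_comp => //; exact: measurableT_comp.
have mz2 : measurable_fun setT (fun p : borel G * (borel G * (borel G * Z)) => p.2.2.2).
  by apply: measurableT_comp => //; exact: measurableT_comp.
rewrite (_ : cell_graph =
  [set s | return_set act Y s.2.2 s.1] `\`
  [set s | exists q, [set p : borel G * (borel G * (borel G * Z)) |
     return_set act Y p.2.2.2 p.1 /\ closer dist prec p.2.2.1 p.1 p.2.1] (q, s)]).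
  apply: measurableD.
    by apply: measurable_return_set => //; exact: measurableT_comp.
  apply: (@measurable_group_proj _ _ _ _ (fun s => s.2.2)).
  - apply: lusin_class_prod; first exact: lusin_class_group.
    by apply: lusin_class_prod; [exact: lusin_class_group|exact: lV].
  - apply: measurableI; first exact: measurable_return_set.
    exact: measurable_closer.
  - by move=> g s [].
rewrite eqEsubset; split => -[g [h z]]; rewrite /cell_graph /=.
  move=> /(voronoi_cellP hdist hprec)[Pg gP]; split => // -[q [Pq]]; exact: gP.
move=> [Pg nP]; apply/(voronoi_cellP hdist hprec); split => // q Pq cl.
by apply: nP; exists q.
Qed.

Lemma measurable_saturation : is_action act -> measurable (saturation act Y).
Proof.
move=> [act1 actM].
rewrite (_ : saturation act Y = [set z | exists g,
  [set gz : borel G * Z | return_set act Y gz.2 gz.1] (g, z)]).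
  apply: (@measurable_group_proj _ _ _ _ id lV) => //.
  exact: measurable_return_set.
rewrite eqEsubset; split => z.
  by move=> [g [y Yy ->]]; exists (g^-1)%g; rewrite /return_set /= -actM mulVg act1.
move=> [g Yg]; exists (g^-1)%g; exists (act g z) => //.
by rewrite -actM mulVg act1.
Qed.
End voronoi_measurability.

(** * The Voronoi formula *)

Section haar.
Context {R : realType} {G : topologicalGroupType} (hG : lcsc G)
  (mG : {measure set (borel G) -> \bar R}) (hmG : haar_measure mG).

Lemma haar_sigma_finite : sigma_finite setT mG.
Proof.
have [hh lG sG] := hG; have [_ fin _] := hmG.
have [K [cK KT]] := sigma_compact lG sG.
exists K => // n; split; last exact: fin.
exact: compact_measurable_borel.
Qed.

Lemma haar_compact_positive : exists K : set (borel G),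
  [/\ compact (K : set G), measurable K, (0 < mG K)%E & (mG K < +oo)%E].
Proof.
have [hh lG sG] := hG; have [_ fin pos] := hmG.
have [K [cK KT]] := sigma_compact lG sG.
have mK n : measurable (K n : set (borel G)) by exact: compact_measurable_borel.
have [[n Kn]|/forallNP K0] := pselect (exists n, (0 < mG (K n))%E).
  by exists (K n); split => //; exact: fin.
have KG n : mG (K n) = 0%E.
  by apply/eqP; rewrite eq_le measure_ge0 andbT leNgt; exact/negP/K0.
have /negligibleP : mG.-negligible (\bigcup_n K n).
  by apply: negligible_bigcup => n; exists (K n); split => //; exact: KG.
by rewrite KT => /(_ measurableT) e; move: pos; rewrite e ltxx.
Qed.

End haar.

Section voronoi_formula.
Context {R : realType} {G : topologicalGroupType} (hG : lcsc G)
  (mG : {measure set (borel G) -> \bar R}) (hmG : haar_measure mG)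
  (mGr : right_invariant_measure mG).
Context d (Z : measurableType d) (V : set (set Z)) (lV : lusin_class V).
Variables (act : G -> Z -> Z) (Y : set Z).
Hypotheses (actA : is_action act) (mact : measurable_fun [set: borel G * Z]
  (fun gz : borel G * Z => act gz.1 gz.2))
  (mY : measurable Y) (finY : forall z, locally_finite (return_set act Y z)).
Variables (dist : G -> G -> R) (prec : G -> G -> Prop).
Hypotheses (hdist : voronoi_metric dist) (hprec : borel_linear_order prec).

Local Notation P := (return_set act Y).
Local Notation cell := (voronoi_cell dist prec).
Local Notation graph := (cell_graph act Y dist prec).

Let mgraph : measurable graph.
Proof. exact: (measurable_cell_graph hG lV mact mY finY hdist hprec). Qed.

Let return_setE g h z : P (act h z) g = P z (g * h)%g.
Proof. by case: actA => _ actM; rewrite /return_set /= actM. Qed.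

Lemma measurable_voronoi_cell z g : measurable (cell (P z) g : set (borel G)).
Proof.
rewrite (_ : cell _ _ = ysection (xsection graph (g : borel G)) z).
  exact/measurable_ysection/measurable_xsection.
by apply/funext => h; rewrite /ysection /= inE /xsection /= inE.
Qed.

Lemma voronoi_cell_act h z g x :
  cell (P (act h z)) (g * h^-1)%g (x * h^-1)%g <-> cell (P z) g x.
Proof.
by apply: (voronoi_cell_mulg hdist hprec) => q; rewrite return_setE mulgVK.
Qed.

(** The cell of the neutral element for [act g z] is the translate by [g^-1] of the
cell of [g] for [z]. *)
Lemma haar_voronoi_cell_act g z : mG (cell (P (act g z)) 1%g) = mG (cell (P z) g).
Proof.
rewrite -(mGr g^-1%g (measurable_voronoi_cell (act g z) 1%g)).
congr (mG _); apply/funext => x /=; apply/propext.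
by rewrite -[1%g](mulgV g) voronoi_cell_act.
Qed.

(** For fixed [z] this is the union of the cells of the points of [P z] in [K]; for
fixed [h] it is the set of [z] for which the centre of the cell containing [h]
lies in [K]. *)
Definition cells_over (K : set G) : set (borel G * Z) :=
  [set hz | exists g, K g /\ cell (P hz.2) g hz.1].

Lemma measurable_cells_over (K : set (borel G)) :
  measurable K -> measurable (cells_over K).
Proof.
move=> mK; rewrite (_ : cells_over K = [set s | exists g,
    (graph `&` fst @^-1` K) (g, s)]); last first.
  rewrite eqEsubset; split => -[h z]; rewrite /cells_over /cell_graph /=.
    by move=> [g [Kg cg]]; exists g.
  by move=> [g [cg Kg]]; exists g.
apply: (measurable_group_proj hG finY (z := snd)
  (lusin_class_prod (lusin_class_group hG) lV)).
  by apply: measurableI => //; apply: measurable_preimage.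
by move=> g [h z] [/(voronoi_cellP hdist hprec)[]].
Qed.

(** Up to the factor [c], the cells of the finitely many points of [P z] in [K] are
disjoint sets with union the section of [cells_over K]. *)
Lemma esum_voronoi_cells (K : set (borel G)) (c : \bar R) z :
  compact (K : set G) -> (0 <= c)%E ->
  (\esum_(g in P z) (mG (cell (P (act g z)) 1%g) * (c * (\1_K g)%:E)) =
   c * mG (ysection (cells_over K) z))%E.
Proof.
move=> cK c0; have finPK := finY z cK.
have -> : ysection (cells_over K) z = \bigcup_(g in P z `&` K) cell (P z) g.
  rewrite eqEsubset; split => h; rewrite /ysection /cells_over /= inE /=.
    move=> [g [Kg cg]]; exists g => //; split => //.
    by case/(voronoi_cellP hdist hprec): cg.
  by move=> [g [_ Kg] cg]; exists g.
rewrite measure_fin_bigcup //; last 2 first.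
- move=> g g' _ _ [h [cg cg']].
  exact: (voronoi_cell_uniq hdist hprec cg cg').
- by move=> g _; exact: measurable_voronoi_cell.
rewrite ge0_mule_fsumr //.
rewrite -esum_fset //; last by move=> g _; rewrite mule_ge0.
rewrite esum_mkcondr.
apply: eq_esum => g _; rewrite haar_voronoi_cell_act indicE.
by case: (g \in K); rewrite ?mule1 ?mule0 // muleC.
Qed.

(** The sum in the transverse measure is taken with the weight [\1_K / mG K]. The
centre of the cell of [h], seen from [act h^-1 z], is [g * h] where [g] is the
centre of the cell of the neutral element, seen from [z]; after the substitution
of [act h^-1 z] for [z], which preserves [nu], the condition that the centre lies
in [K] holds for [h] in a left translate of [K]. *)
Lemma measure_saturation_voronoi
    (nu rho : {measure set Z -> \bar R}) :
  invariant_measure act nu -> sigma_finite setT nu ->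
  transverse_measure mG act nu Y rho ->
  nu (saturation act Y) = (\int[rho]_(y in Y) mG (cell (P y) 1%g))%E.
Proof.
move=> inv snu trans; have sG := haar_sigma_finite hG hmG.
have [mGl _ _] := hmG; have [act1 actM] := actA.
have [K [cK mK K0 Kfin]] := haar_compact_positive hG hmG.
have Kfn : mG K \is a fin_num by rewrite ge0_fin_numE.
pose c := (fine (mG K))^-1.
have c0 : 0 <= c by rewrite invr_ge0 fine_ge0.
have cK1 : (c%:E * mG K = 1)%E.
  rewrite -(fineK Kfn) -EFinM mulVf // gt_eqF //.
  by apply: fine_gt0; rewrite K0.
have mU := measurable_cells_over mK.
pose f y := mG (cell (P y) 1%g).
have mf : measurable_fun setT f.
  rewrite (_ : f = fun y => mG (ysection (xsection graph (1%g : borel G)) y)).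
    exact/measurable_fun_measure_ysection/measurable_xsection.
  apply/funext => y; rewrite /f; congr (mG _); apply/funext => h.
  by rewrite /ysection /= inE /xsection /= inE.
have -> : (\int[rho]_(y in Y) mG (cell (P y) 1%g) = \int[rho]_y f y)%E.
  rewrite integral_mkcond; apply: eq_integral => y _; rewrite patchE.
  case: ifPn => // /negP nYy; rewrite /f (_ : cell _ _ = set0) ?measure0 //.
  rewrite -subset0 => h /(voronoi_cellP hdist hprec)[+ _].
  by rewrite /return_set /= act1 => Yy; apply: nYy; rewrite inE.
have -> := trans (fun g => c%:E * (\1_K g)%:E)%E _ _ _ f mf (fun=> measure_ge0 _ _).
- under eq_integral do rewrite esum_voronoi_cells //.
  rewrite ge0_integralZl //; last first.
    exact: measurable_fun_measure_ysection.
  rewrite -(fubini_sections sG snu mU).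
  (* the same sets after the substitution of act h^-1 z for z *)
  pose W : set (borel G * Z) := [set hz | cells_over K (hz.1, act hz.1^-1%g hz.2)].
  have mW : measurable W.
    apply: (@measurable_preimage _ _ _ _ (fun hz : borel G * Z =>
      (hz.1, act hz.1^-1%g hz.2) : borel G * Z) _ _ mU).
    apply: measurable_fun_pair => //.
    apply: (@measurableT_comp _ _ _ _ _ _ (fun gz : borel G * Z => act gz.1 gz.2)
      _ (fun hz : borel G * Z => (hz.1^-1%g, hz.2))) => //.
    by apply: measurable_fun_pair => //; exact: measurable_invg.
  have -> : (\int[mG]_h nu (xsection (cells_over K) h) =
             \int[mG]_h nu (xsection W h))%E.
    apply: eq_integral => h _.
    have mUh : measurable (xsection (cells_over K) h) by exact: measurable_xsection.
    rewrite -(inv (h : G)^-1%g _ mUh).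
    by congr (nu _); apply/funext => z; rewrite /= !inE.
  rewrite (fubini_sections sG snu mW).
  have msat : measurable (saturation act Y).
    exact: (measurable_saturation hG lV mact mY finY actA).
  have -> : (\int[nu]_z mG (ysection W z) =
             \int[nu]_z (mG K * (\1_(saturation act Y) z)%:E))%E.
    apply: eq_integral => z _; rewrite indicE.
    have WE h : ysection W z h <-> exists g, K (g * h)%g /\ cell (P z) g 1%g.
      rewrite /ysection /W /cells_over /= inE /=; split => -[g [Kg cg]].
        exists (g * h^-1)%g; rewrite mulgVK; split => //.
        apply/(voronoi_cell_act h^-1%g); move: cg.
        by rewrite invgK mulgVK mul1g.
      exists (g * h)%g; split => //.
      have /(voronoi_cell_act h^-1%g) := cg.
      by rewrite invgK mul1g.
    have [/set_mem[g0 [y Yy zE]]|/negP nsat] := boolP (z \in saturation act Y); last first.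
      rewrite mule0 (_ : ysection W z = set0) ?measure0 //.
      rewrite -subset0 => h /WE[g [_ /(voronoi_cellP hdist hprec)[Pg _]]].
      apply: nsat; rewrite inE; exists (g^-1)%g; exists (act g z) => //.
      by rewrite -actM mulVg act1.
    rewrite mule1.
    have [g Pg cg] : exists2 g, P z g & cell (P z) g 1%g.
      apply: (exists_voronoi_cell hdist hprec) => //.
      by exists (g0^-1)%g; rewrite /return_set /= zE -actM mulVg act1.
    rewrite -(mGl g K mK); congr (mG _); rewrite eqEsubset; split => h /=.
      by move=> /WE[g' [Kg' /(voronoi_cell_uniq hdist hprec cg) ->]].
    by move=> Kgh; apply/WE; exists g.
  rewrite ge0_integralZl //; last first.
    by apply/measurable_EFinP; exact: measurable_indic.
  by rewrite integral_indic // setIT muleA cK1 mul1e.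
- by apply: measurable_funeM; apply/measurable_EFinP; exact: measurable_indic.
- by move=> g; rewrite mule_ge0 // lee_fin.
- rewrite ge0_integralZl //; last first.
    by apply/measurable_EFinP; exact: measurable_indic.
  by rewrite integral_indic // setIT.
Qed.

End voronoi_formula.

(** * The diagonal action *)

Lemma diag_act_is_action (G : topologicalGroupType) T r (act : G -> T -> T) :
  is_action act -> is_action (diag_act r act).
Proof.
move=> [act1 actM]; split => [x|g h x]; apply: eq_from_tnth => i.
  by rewrite tnth_map act1.
by rewrite !tnth_map actM.
Qed.

Lemma measurable_diag_act (G : topologicalGroupType) d (X : measurableType d) r
    (act : G -> X -> X) :
  measurable_fun [set: borel G * X] (fun gx : borel G * X => act gx.1 gx.2) ->
  measurable_fun [set: borel G * r.-tuple X]
    (fun gx : borel G * r.-tuple X => diag_act r act gx.1 gx.2).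
Proof.
move=> mact; apply/measurable_fun_tnthP => i.
rewrite (_ : _ \o _ = fun gx : borel G * r.-tuple X => act gx.1 (tnth gx.2 i)); last first.
  by apply/funext => gx /=; rewrite tnth_map.
apply: (@measurableT_comp _ _ _ _ _ _ (fun gz : borel G * X => act gz.1 gz.2)
  _ (fun gx : borel G * r.-tuple X => (gx.1, tnth gx.2 i))) => //.
apply: measurable_fun_pair => //.
exact: (measurableT_comp (measurable_tnth i)).
Qed.

Lemma measurable_set_power d (X : measurableType d) r (Y : set X) :
  measurable Y -> measurable (set_power r Y).
Proof.
move=> mY.
rewrite (_ : set_power r Y = \bigcap_(i in [set: 'I_r]) ((@tnth r X ^~ i) @^-1` Y)).
  apply: fin_bigcap_measurable => // i _.
  by apply: measurable_preimage => //; exact: measurable_tnth.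
by rewrite eqEsubset; split => [x Yx i _|x Yx i]; exact: Yx.
Qed.

Lemma return_set_diag (G : topologicalGroupType) T r (act : G -> T -> T) (Y : set T) x :
  return_set (diag_act r act) (set_power r Y) x =
  \bigcap_(i in [set: 'I_r]) return_set act Y (tnth x i).
Proof.
by rewrite eqEsubset; split => g Yg i; have := Yg i; rewrite /return_set /= tnth_map // => /(_ I).
Qed.

(** The return set of a tuple is contained in that of its first entry, which
exists because [r] is positive; outside the saturation it is empty. *)
Lemma locally_finite_diag (G : topologicalGroupType) T r (act : G -> T -> T) (Y : set T) :
  is_action act -> (0 < r)%N ->
  (forall x, saturation act Y x -> locally_finite (return_set act Y x)) ->
  forall x, locally_finite (return_set (diag_act r act) (set_power r Y) x).
Proof.
move=> [act1 actM] r0 fin x K cK; rewrite return_set_diag.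
pose y := tnth x (Ordinal r0).
suff : locally_finite (return_set act Y y).
  move=> /(_ K cK); apply: sub_finite_set; apply: setSI => g /(_ (Ordinal r0)).
  exact.
have [/fin //|nsat] := pselect (saturation act Y y).
move=> K' _; rewrite (_ : _ `&` _ = set0) //.
rewrite -subset0 => g [Yg _]; apply: nsat.
by exists (g^-1)%g; exists (act g y) => //; rewrite -actM mulVg act1.
Qed.

Unset Implicit Arguments.

Theorem proposition7p4 (R : realType) (G : topologicalGroupType)
  (hG : lcsc G) (hU : unimodular R G)
  (mG : {measure set (borel G) -> \bar R}) (hmG : haar_measure mG)
  (d : measure_display) (X : measurableType d) (act : G -> X -> X)
  (mu : probability X R) (Y : set X)
  (hXY : transverse_space act mu Y)
  (muY : {measure set X -> \bar R})
  (hmuY : transverse_measure mG act mu Y muY)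
  (r : nat) (hr : (0 < r)%N)
  (muYr : {measure set (r.-tuple X) -> \bar R})
  (hmuYr : power_measure muY muYr)
  (mur : {measure set (r.-tuple X) -> \bar R})
  (hmur : intersection_measure mG act Y muYr mur)
  (dist : G -> G -> R) (hdist : voronoi_metric dist)
  (prec : G -> G -> Prop) (hprec : borel_linear_order prec) :
  mur (diag_saturation r act Y) =
  (\int[muYr]_(y in set_power r Y)
     mG (voronoi_cell dist prec
           (\bigcap_(i in [set: 'I_r]) return_set act Y (tnth y i))
           (1%g : G)))%E.
Proof.
have [[sX actA mact] _ mY _ [finY _]] := hXY.
have [inv smur _ trans] := hmur.
have [U lU] := lusin_class_standard_borel sX.
have [V lV] := lusin_class_tuple r lU.
rewrite /diag_saturation.
rewrite (@measure_saturation_voronoi R G hG mG hmG (hU mG hmG) _ _ V lV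
  (diag_act r act) (set_power r Y) (diag_act_is_action r actA)
  (measurable_diag_act mact) (measurable_set_power mY)
  (locally_finite_diag actA hr finY) dist prec hdist hprec mur muYr inv smur trans).
by apply: eq_integral => y _; rewrite return_set_diag.
Qed.
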